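(* Let $R$ be a basic formal matrix ring of order $n$ with coordinate bimodules $B_{i,j}$, with Nakayama permutation $\pi=(1~2~\dots~n)$, and whose right socle is an essential right ideal. Indices are taken in $\mathbb{Z}_n$, i.e. indices congruent modulo $n$ are identified. Let $i,k\in\mathbb{Z}_n$ with $k\neq 0$ and $k\neq 1$, and assume that $B_{i,i+k}$ is nonzero. Then for any $j\in\mathbb{Z}_n$, the bimodules $B_{j,j+k}$ and $B_{j,j-k+1}$ are nonzero.
   Context: Rings are associative and unital; $J(R)$ is the Jacobson radical. Formal matrix ring of order $n$: given local rings $R_1,\dots,R_n$, $R_i$-$R_j$-bimodules $B_{i,j}$ (coordinate bimodules) with $B_{i,i}=R_i$, and $R_i$-$R_k$-bimodule homomorphisms $\varphi_{i,j,k}\colon B_{i,j}\otimes_{R_j}B_{j,k}\to B_{i,k}$, written $ab:=\varphi_{i,j,k}(a\otimes b)$, where $\varphi_{i,i,j}$ and $\varphi_{i,j,j}$ are the bimodule actions and $(ab)c=a(bc)$ for all $a\in B_{i,j}$, $b\in B_{j,k}$, $c\in B_{k,l}$. The ring $R$ is the set of $n\times n$ matrices whose $(i,j)$ entry lies in $B_{i,j}$, with the usual matrix addition and multiplication. The canonical idempotent $e_i$ is the matrix with $1_{R_i}$ at position $(i,i)$ and zeros elsewhere. $R$ is basic if the right modules $e_1R,\dots,e_nR$ are pairwise non-isomorphic. Nakayama permutation: a basic formal matrix ring $R$ of order $n$ is a ring with a Nakayama permutation $\pi\in S_n$ if for each $i\le n$ one has $soc(e_iR)\cong top(e_{\pi(i)}R)$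 as right $R$-modules and $soc(Re_{\pi(i)})\cong top(Re_i)$ as left $R$-modules, where $top(M)=M/MJ(R)$ (resp. $M/J(R)M$). Here $(1~2~\dots~n)$ is the cycle $i\mapsto i+1$ modulo $n$. *)

(* Defs.v *)
From HB Require Import structures.
From mathcomp Require Import all_boot all_order all_fingroup all_algebra.
From mathcomp Require Import boolp classical_sets.
From mathcomp Require Import generic_quotient ring_quotient.

Set Implicit Arguments.
Unset Strict Implicit.
Unset Printing Implicit Defensive.

Import GRing.Theory.
Local Open Scope ring_scope.
Local Open Scope quotient_scope.
Local Open Scope classical_set_scope.

(** Modules are left modules [lmodType S] over a (possibly noncommutative,
    infinite) ring [S].  Right [R]-modules are the left modules over the converse
    ring [R^c]; in particular [R^c^o] is the right regular module of [R], with
    [(r : R^c) *: x = x * r], and its submodules are the right ideals of [R].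
    Submodules are the library's [submodClosed V]; classically every Prop-valued
    submodule is of this form, through [asbool]. *)

Section Submodules.
Variables (S : pzRingType) (V : lmodType S).

Definition submod_span_pred (A : set V) : {pred V} := fun x =>
  `[< forall U : submodClosed V, (forall y, A y -> y \in U) -> x \in U >].

Lemma submod_span_closed (A : set V) : submod_closed (submod_span_pred A).
Proof.
split; first by apply/asboolP => U _; rewrite rpred0.
move=> a x y /asboolP hx /asboolP hy; apply/asboolP => U AU.
by rewrite rpredD ?rpredZ ?hx ?hy.
Qed.

HB.instance Definition _ (A : set V) :=
  GRing.isSubmodClosed.Build S V (submod_span_pred A) (submod_span_closed A).

Definition submod_span (A : set V) : submodClosed V := submod_span_pred A.

Definition cyclic_pred (v : V) : {pred V} := fun x =>
  `[< exists s : S, x = s *: v >].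

Lemma cyclic_closed (v : V) : submod_closed (cyclic_pred v).
Proof.
split; first by apply/asboolP; exists 0; rewrite scale0r.
move=> a _ _ /asboolP [s ->] /asboolP [t ->]; apply/asboolP.
by exists (a * s + t); rewrite scalerDl scalerA.
Qed.

HB.instance Definition _ (v : V) :=
  GRing.isSubmodClosed.Build S V (cyclic_pred v) (cyclic_closed v).

Definition cyclic_submod (v : V) : submodClosed V := cyclic_pred v.

Definition nonzero_submod (U : submodClosed V) : Prop :=
  exists2 x, x \in U & x != 0.

Definition simple_submod (U : submodClosed V) : Prop :=
  nonzero_submod U /\
  forall W : submodClosed V, {subset W <= U} -> nonzero_submod W -> W =i U.

Definition maximal_submod (U : submodClosed V) : Prop :=
  (exists x, x \notin U) /\
  forall W : submodClosed V,
    {subset U <= W} -> (exists x, x \notin W) -> W =i U.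

Definition essential_submod (U : submodClosed V) : Prop :=
  forall W : submodClosed V,
    nonzero_submod W -> exists x, [/\ x \in U, x \in W & x != 0].

Definition soc : submodClosed V :=
  submod_span [set x | exists2 U : submodClosed V, simple_submod U & x \in U].

Definition ideal_mul (A : set S) : submodClosed V :=
  submod_span [set y | exists a x, A a /\ y = a *: x].

End Submodules.

Arguments soc {S} V.
Arguments ideal_mul {S} V A.

Section SubQuotientModules.
Variables (S : pzRingType) (V : lmodType S) (U : submodClosed V).

Definition submod_type : Type := {x : V | x \in U}.

HB.instance Definition _ := SubType.on submod_type.
HB.instance Definition _ := Choice.on submod_type.
HB.instance Definition _ := [SubChoice_isSubLmodule of submod_type by <:].

(* Over a ring, closure under opposites is derivable, but it is not part of
   [submodClosed]; the library's quotient of groups requires a [zmodClosed]. *)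
Definition zmod_pred : {pred V} := fun x => x \in U.

Lemma zmod_pred_closed : zmod_closed zmod_pred.
Proof. exact: GRing.submod_closedB (submodClosedP U). Qed.

HB.instance Definition _ :=
  GRing.isZmodClosed.Build V zmod_pred zmod_pred_closed.

Definition factor_type : Type := Quotient.quot zmod_pred.

HB.instance Definition _ := EqQuotient.on factor_type.
HB.instance Definition _ := GRing.Zmodule.on factor_type.

Definition factor_scale (a : S) (x : factor_type) : factor_type :=
  \pi_factor_type (a *: repr x).

Lemma pi_factor_scale a (x : V) :
  factor_scale a (\pi_factor_type x) = \pi_factor_type (a *: x).
Proof.
apply/eqP; rewrite /factor_scale -Quotient.idealrBE -scalerBr.
have : repr (\pi_factor_type x) - x \in zmod_pred.
  by rewrite Quotient.idealrBE reprK.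
exact: (rpredZ a).
Qed.

Lemma pi_factorD (x y : V) :
  \pi_factor_type (x + y) = \pi_factor_type x + \pi_factor_type y.
Proof. exact: (@Quotient.pi_add V zmod_pred). Qed.

Lemma factor_scalerA a b x : factor_scale a (factor_scale b x) = factor_scale (a * b) x.
Proof. by elim/quotW: x => x; rewrite (pi_factor_scale b) !pi_factor_scale scalerA. Qed.

Lemma factor_scale1r : left_id 1 factor_scale.
Proof. by elim/quotW => x; rewrite pi_factor_scale scale1r. Qed.

Lemma factor_scalerDr : right_distributive factor_scale +%R.
Proof.
move=> a; elim/quotW => x; elim/quotW => y.
by rewrite -pi_factorD !pi_factor_scale scalerDr pi_factorD.
Qed.

Lemma factor_scalerDl x : {morph factor_scale^~ x : a b / a + b}.
Proof.
elim/quotW: x => x a b.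
by rewrite !pi_factor_scale scalerDl pi_factorD.
Qed.

HB.instance Definition _ := GRing.Zmodule_isLmodule.Build S factor_type
  factor_scalerA factor_scale1r factor_scalerDr factor_scalerDl.

End SubQuotientModules.

Definition lmod_iso (S : pzRingType) (V W : lmodType S) : Prop :=
  exists f : {linear V -> W}, bijective f.

Definition jacobson (R : pzRingType) : set R :=
  [set x | forall U : submodClosed R^c^o, maximal_submod U -> x \in U].

(* [R / J(R)] is a division ring. *)
Definition local_ring (R : pzRingType) : Prop :=
  ~ jacobson (1 : R) /\
  forall a : R, ~ jacobson a ->
    exists b : R, jacobson (1 - a * b) /\ jacobson (1 - b * a).

Section OneSided.
Variable R : pzRingType.

Definition right_top (M : lmodType R^c) : lmodType R^c :=
  factor_type (ideal_mul M (@jacobson R)).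

Definition left_top (M : lmodType R) : lmodType R :=
  factor_type (ideal_mul M (@jacobson R)).

Definition right_soc_type (M : lmodType R^c) : lmodType R^c :=
  submod_type (soc M).

Definition left_soc_type (M : lmodType R) : lmodType R :=
  submod_type (soc M).

Definition right_principal (e : R) : lmodType R^c :=
  submod_type (cyclic_submod (e : R^c^o)).

Definition left_principal (e : R) : lmodType R :=
  submod_type (cyclic_submod (e : R^o)).

Definition right_socle_essential : Prop := essential_submod (soc R^c^o).

End OneSided.

(** The coordinate bimodules [B_{i,j}] with their products.  Since [B_{i,i} = R_i]
    and [phi_{i,i,j}], [phi_{i,j,j}] are the bimodule actions, all the structure is
    carried by the products: for suitable coinciding indices, the axioms below are
    the ring axioms of [R_i], the bimodule axioms of [B_{i,j}], and the facts that
    each product is balanced over [R_j] and is an [R_i]-[R_k]-bimodule map, i.e.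
    that it is a homomorphism [B_{i,j} (x)_{R_j} B_{j,k} -> B_{i,k}]. *)
Record formal_matrix_data (n : nat) := FormalMatrixData {
  bimod : 'I_n -> 'I_n -> zmodType;
  cmul : forall i j k, bimod i j -> bimod j k -> bimod i k;
  cone : forall i, bimod i i;
  cmulDl : forall i j k (a b : bimod i j) (c : bimod j k),
    cmul (a + b) c = cmul a c + cmul b c;
  cmulDr : forall i j k (a : bimod i j) (b c : bimod j k),
    cmul a (b + c) = cmul a b + cmul a c;
  cmulA : forall i j k l (a : bimod i j) (b : bimod j k) (c : bimod k l),
    cmul a (cmul b c) = cmul (cmul a b) c;
  cmul1l : forall i j (a : bimod i j), cmul (cone i) a = a;
  cmul1r : forall i j (a : bimod i j), cmul a (cone j) = a
}.

Section FormalMatrixRing.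
Variables (n : nat) (F : formal_matrix_data n).

Definition diag_ring (i : 'I_n) : Type := bimod F i i.

HB.instance Definition _ i := GRing.Zmodule.on (diag_ring i).
HB.instance Definition _ i := GRing.Zmodule_isPzRing.Build (diag_ring i)
  (@cmulA n F i i i i) (@cmul1l n F i i) (@cmul1r n F i i)
  (@cmulDl n F i i i) (@cmulDr n F i i i).

Definition fmatrix : Type :=
  {dffun forall p : 'I_n * 'I_n, bimod F p.1 p.2}.

HB.instance Definition _ := Choice.on fmatrix.

Definition entry (A : fmatrix) i j : bimod F i j := A (i, j).

Definition fmx (g : forall i j, bimod F i j) : fmatrix :=
  [ffun p : 'I_n * 'I_n => g p.1 p.2 : bimod F p.1 p.2].

Lemma fmxE g i j : entry (fmx g) i j = g i j.
Proof. by rewrite /entry /fmx ffunE. Qed.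

Lemma fmatrixP (A B : fmatrix) :
  (forall i j, entry A i j = entry B i j) -> A = B.
Proof. by move=> AB; apply/ffunP => -[i j]; exact: AB. Qed.

Definition fmx_zero : fmatrix := fmx (fun i j => 0).
Definition fmx_opp (A : fmatrix) : fmatrix := fmx (fun i j => - entry A i j).
Definition fmx_add (A B : fmatrix) : fmatrix :=
  fmx (fun i j => entry A i j + entry B i j).

Lemma fmx_addA : associative fmx_add.
Proof. by move=> A B C; apply: fmatrixP => i j; rewrite !fmxE addrA. Qed.

Lemma fmx_addC : commutative fmx_add.
Proof. by move=> A B; apply: fmatrixP => i j; rewrite !fmxE addrC. Qed.

Lemma fmx_add0 : left_id fmx_zero fmx_add.
Proof. by move=> A; apply: fmatrixP => i j; rewrite !fmxE add0r. Qed.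

Lemma fmx_addN : left_inverse fmx_zero fmx_opp fmx_add.
Proof. by move=> A; apply: fmatrixP => i j; rewrite !fmxE addNr. Qed.

HB.instance Definition _ :=
  GRing.isZmodule.Build fmatrix fmx_addA fmx_addC fmx_add0 fmx_addN.

Lemma cmul0l i j k (b : bimod F j k) : cmul (0 : bimod F i j) b = 0.
Proof. by apply: (addrI (cmul 0 b)); rewrite -cmulDl !addr0. Qed.

Lemma cmul0r i j k (a : bimod F i j) : cmul a (0 : bimod F j k) = 0.
Proof. by apply: (addrI (cmul a 0)); rewrite -cmulDr !addr0. Qed.

Lemma cmul_suml i j k (f : 'I_n -> bimod F i j) (b : bimod F j k) :
  cmul (\sum_l f l) b = \sum_l cmul (f l) b.
Proof.
by apply: (big_morph (fun a => cmul a b)) => [x y|];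
  rewrite (cmulDl, cmul0l).
Qed.

Lemma cmul_sumr i j k (a : bimod F i j) (f : 'I_n -> bimod F j k) :
  cmul a (\sum_l f l) = \sum_l cmul a (f l).
Proof.
by apply: (big_morph (fun b => cmul a b)) => [x y|];
  rewrite (cmulDr, cmul0r).
Qed.

(* The matrix with [x] at position [(i, j)] and zeros elsewhere. *)
Definition unit_entry i j (x : bimod F i j) k l : bimod F k l :=
  match @eqP _ i k, @eqP _ j l with
  | ReflectT eik, ReflectT ejl =>
      ecast k' (bimod F k' l) eik (ecast l' (bimod F i l') ejl x)
  | _, _ => 0
  end.

Definition fdelta i j (x : bimod F i j) : fmatrix := fmx (unit_entry x).

Lemma unit_entry_eq i j (x : bimod F i j) : unit_entry x i j = x.
Proof.
rewrite /unit_entry; case: eqP => // eii; case: eqP => // ejj.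
by rewrite (eq_irrelevance eii erefl) (eq_irrelevance ejj erefl).
Qed.

Lemma unit_entry_neq i j (x : bimod F i j) k l :
  (i, j) != (k, l) -> unit_entry x k l = 0.
Proof.
rewrite xpair_eqE /unit_entry; case: eqP => // eik; case: eqP => // ejl.
Qed.

Definition fmx_one : fmatrix := \sum_i fdelta (cone F i).
Definition fmx_mul (A B : fmatrix) : fmatrix :=
  fmx (fun i k => \sum_j cmul (entry A i j) (entry B j k)).

Lemma entry_sum (I : Type) (r : seq I) (G : I -> fmatrix) i j :
  entry (\sum_(l <- r) G l) i j = \sum_(l <- r) entry (G l) i j.
Proof.
elim: r => [|l r IH]; first by rewrite !big_nil; exact: fmxE.
by rewrite !big_cons -IH; exact: fmxE.
Qed.

Lemma fmx_mulA : associative fmx_mul.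
Proof.
move=> A B C; apply: fmatrixP => i l; rewrite !fmxE.
under eq_bigr do rewrite fmxE cmul_sumr.
under [RHS]eq_bigr do rewrite fmxE cmul_suml.
rewrite exchange_big /=; apply: eq_bigr => k _; apply: eq_bigr => j _.
exact: cmulA.
Qed.

Lemma entry_one_diag i : entry fmx_one i i = cone F i.
Proof.
rewrite entry_sum (bigD1 i) //= fmxE unit_entry_eq big1 ?addr0 // => k ki.
by rewrite fmxE unit_entry_neq // xpair_eqE (negPf ki).
Qed.

Lemma entry_one_off i j : i != j -> entry fmx_one i j = 0.
Proof.
move=> ij; rewrite entry_sum big1 // => k _.
rewrite fmxE unit_entry_neq // xpair_eqE negb_and.
by case: (eqVneq k i) => // ->.
Qed.

Lemma fmx_mul1l : left_id fmx_one fmx_mul.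
Proof.
move=> A; apply: fmatrixP => i k; rewrite fmxE (bigD1 i) //=.
rewrite entry_one_diag cmul1l big1 ?addr0 // => j ji.
by rewrite entry_one_off 1?eq_sym // cmul0l.
Qed.

Lemma fmx_mul1r : right_id fmx_one fmx_mul.
Proof.
move=> A; apply: fmatrixP => i k; rewrite fmxE (bigD1 k) //=.
rewrite entry_one_diag cmul1r big1 ?addr0 // => j ji.
by rewrite entry_one_off // cmul0r.
Qed.

Lemma fmx_mulDl : left_distributive fmx_mul +%R.
Proof.
move=> A B C; apply: fmatrixP => i k; rewrite !fmxE -big_split.
apply: eq_bigr => j _; rewrite /= -cmulDl; congr cmul; exact: fmxE.
Qed.

Lemma fmx_mulDr : right_distributive fmx_mul +%R.
Proof.
move=> A B C; apply: fmatrixP => i k; rewrite !fmxE -big_split.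
apply: eq_bigr => j _; rewrite /= -cmulDr; congr cmul; exact: fmxE.
Qed.

HB.instance Definition _ := GRing.Zmodule_isPzRing.Build fmatrix
  fmx_mulA fmx_mul1l fmx_mul1r fmx_mulDl fmx_mulDr.

Definition canon_idem (i : 'I_n) : fmatrix := fdelta (cone F i).

Definition local_coordinates : Prop :=
  forall i : 'I_n, local_ring (diag_ring i).

Definition basic : Prop :=
  forall i j : 'I_n, i != j ->
    ~ lmod_iso (right_principal (canon_idem i))
               (right_principal (canon_idem j)).

Definition nakayama_permutation (s : {perm 'I_n}) : Prop :=
  forall i : 'I_n,
    lmod_iso (right_soc_type (right_principal (canon_idem i)))
             (right_top (right_principal (canon_idem (s i)))) /\
    lmod_iso (left_soc_type (left_principal (canon_idem (s i))))
             (left_top (left_principal (canon_idem i))).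

Definition nonzero_bimod (i j : 'I_n) : Prop := exists x : bimod F i j, x != 0.

End FormalMatrixRing.

(* The cycle [(1 2 ... n)]: [ordS i] is [i + 1] modulo [n]. *)
Definition full_cycle (n : nat) : {perm 'I_n} := perm (@ordS_inj n).

(* Main.v *)
Require Import Defs.
From mathcomp Require Import all_boot all_fingroup all_algebra.
From HB Require Import structures.
From mathcomp Require Import boolp generic_quotient ring_quotient.

(** The proof rests on one implication: if [B_{p,q}] is nonzero, then so is
    [B_{q,p+1}].  Applied twice it leads from [B_{p,p+k}] to [B_{p+k,p+1}] and
    then to [B_{p+1,p+1+k}], so that going round the cycle makes every
    [B_{j,j+k}] nonzero; applied once more to [B_{j-k,j}] it gives
    [B_{j,j-k+1}].

    For the implication ([nakayama_nonzero]), let [x] be a nonzero element of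
    [B_{p,q}], seen as a matrix.  The right socle of [R] is essential, so the
    right ideal [xR], which lies in [e_p R], contains a nonzero element [u = xa]
    of the socle.  Left multiplication by [e_p] is a homomorphism of right
    modules from [R] to [e_p R] that fixes [u], and homomorphisms preserve
    socles ([soc_linear]); hence [u] lies in [soc(e_p R)], which is isomorphic
    to [top(e_{p+1} R)].  No nonzero element of [top(eR)] is killed by [Re]
    when [e] is idempotent ([right_top_mul_neq0]), so [u r e_{p+1}] is nonzero
    for some [r].  This matrix has a single nonzero entry, the product of [x]
    with the entry of [ar] in [B_{q,p+1}], and that entry is therefore
    nonzero. *)

Set Implicit Arguments.
Unset Strict Implicit.
Unset Printing Implicit Defensive.

Import GRing.Theory.
Local Open Scope ring_scope.
Local Open Scope quotient_scope.

(** * Socles under homomorphisms *)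

Section Generated.
Variables (S : pzRingType) (V : lmodType S).

Lemma mem_submod_span (A : classical_sets.set V) x : A x -> x \in submod_span A.
Proof. by move=> Ax; apply/asboolP => U AU; apply: AU. Qed.

Lemma mem_cyclic_submod (v : V) : v \in cyclic_submod v.
Proof. by apply/asboolP; exists 1; rewrite scale1r. Qed.

End Generated.

Section Socle.
Variables (S : pzRingType) (V W : lmodType S) (f : {linear V -> W}).

(** [f] is injective on [U] because its kernel there is a proper submodule of a
    simple module; the image is generated by any of its nonzero elements. *)
Lemma simple_image_cyclic (U : submodClosed V) x :
  simple_submod U -> x \in U -> f x != 0 -> simple_submod (cyclic_submod (f x)).
Proof.
move=> [_ Umin] xU fx0; split; first by exists (f x); first exact: mem_cyclic_submod.
move=> T subT [w wT w0] y; apply/idP/idP; first exact: subT.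
have /asboolP [s ws] := subT w wT; rewrite -linearZ in ws.
have sx0 : s *: x != 0 by apply: contraNneq w0; rewrite ws => ->; rewrite linear0.
have cycU : {subset cyclic_submod (s *: x) <= U}.
  by move=> _ /asboolP [a ->]; rewrite !rpredZ.
have : x \in cyclic_submod (s *: x).
  rewrite (Umin _ cycU) //; exists (s *: x) => //; exact: mem_cyclic_submod.
move=> /asboolP [t xt] /asboolP [a ->].
by rewrite rpredZ // xt linearZ -ws rpredZ.
Qed.

Definition preim_pred (U : submodClosed W) : {pred V} := fun x => f x \in U.

Lemma preim_closed U : submod_closed (preim_pred U).
Proof.
split; first by rewrite /in_mem /= /preim_pred linear0 rpred0.
move=> a x y; rewrite /in_mem /= /preim_pred => xU yU.
by rewrite linearP rpredD ?rpredZ.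
Qed.

HB.instance Definition _ U :=
  GRing.isSubmodClosed.Build S V (preim_pred U) (preim_closed U).

Definition preim_submod (U : submodClosed W) : submodClosed V := preim_pred U.

(** The preimage of [soc W] is a submodule, so it suffices that it contains
    every simple submodule of [V]. *)
Lemma soc_linear x : x \in soc V -> f x \in soc W.
Proof.
move=> /asboolP /(_ (preim_submod (soc W))); apply=> y [U simU yU].
change (f y \in soc W); have [->|fy0] := eqVneq (f y) 0; first by rewrite rpred0.
apply: mem_submod_span; exists (cyclic_submod (f y)).
  exact: simple_image_cyclic simU yU fy0.
exact: mem_cyclic_submod.
Qed.

End Socle.

(** * Maximal submodules and the Jacobson radical *)

Section Maximal.
Variables (S : pzRingType) (V : lmodType S).

Definition add_cyclic_pred (U : submodClosed V) (v : V) : {pred V} := fun x =>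
  `[< exists2 u, u \in U & exists s : S, x = u + s *: v >].

Lemma add_cyclic_closed U v : submod_closed (add_cyclic_pred U v).
Proof.
split; first by apply/asboolP; exists 0; [rewrite rpred0|exists 0; rewrite scale0r addr0].
move=> a _ _ /asboolP [u uU [s ->]] /asboolP [w wU [t ->]]; apply/asboolP.
exists (a *: u + w); first by rewrite rpredD ?rpredZ.
by exists (a * s + t); rewrite scalerDr scalerDl scalerA addrACA.
Qed.

HB.instance Definition _ U v :=
  GRing.isSubmodClosed.Build S V (add_cyclic_pred U v) (add_cyclic_closed U v).

Definition add_cyclic (U : submodClosed V) v : submodClosed V :=
  add_cyclic_pred U v.

(** This is the form in which maximality is used below: modulo a maximal
    submodule, every element outside of it generates the whole module. *)
Lemma maximal_submodP (U : submodClosed V) v y :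
  maximal_submod U -> v \notin U -> exists s : S, y - s *: v \in U.
Proof.
move=> [_ Umax] vU.
have subU : {subset U <= add_cyclic U v}.
  by move=> x xU; apply/asboolP; exists x => //; exists 0; rewrite scale0r addr0.
have [/asboolP [u uU [s ->]]|yN] := boolP (y \in add_cyclic U v).
  by exists s; rewrite addrK.
case/negP: vU; rewrite -(Umax _ subU); last by exists y.
by apply/asboolP; exists 0; [rewrite rpred0|exists 1; rewrite scale1r add0r].
Qed.

End Maximal.

(** [V] modulo the preimage of [U] embeds into the simple module [W / U], onto
    which it maps since [f v] is not in [U]. *)
Lemma maximal_preim (S : pzRingType) (V W : lmodType S) (f : {linear V -> W})
    (U : submodClosed W) v :
  maximal_submod U -> f v \notin U -> maximal_submod (preim_submod f U).
Proof.
move=> maxU fvU; split; first by exists v.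
move=> T subT [y yT] x; apply/idP/idP; last exact: subT.
move=> xT; apply/negPn/negP => fxU.
have [s yxU] := maximal_submodP (f y) maxU fxU.
case/negP: yT; rewrite -(subrK (s *: x) y) rpredD ?rpredZ //.
by apply: subT; rewrite /in_mem /= /preim_pred linearB linearZ.
Qed.

Section Jacobson.
Variable R : pzRingType.
Implicit Types (U : submodClosed R^c^o) (a r : R).

Lemma rpredMr U a r : a \in U -> a * r \in U.
Proof. exact: (@rpredZ _ _ U (r : R^c)). Qed.

Definition lmul a (r : R^c^o) : R^c^o := a * (r : R).

Lemma linear_lmul a : linear (lmul a).
Proof.
by move=> c x y; rewrite /lmul mulrDr; congr (_ + _); exact: (mulrA a (x : R) (c : R)).
Qed.

HB.instance Definition _ a :=
  GRing.isLinear.Build R^c R^c^o R^c^o _ (lmul a) (linear_lmul a).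

(** The radical, an intersection of maximal right ideals, is also a left ideal:
    [a * r] lies in [U] if and only if [r] lies in the preimage of [U] under
    left multiplication by [a], which is a maximal right ideal or all of [R]. *)
Lemma jacobson_lmul a r : jacobson r -> jacobson (a * r).
Proof.
move=> Jr U maxU; have [aU|aU] := boolP ((a : R^c^o) \in U); first exact: rpredMr.
apply: (Jr (preim_submod (lmul a) U)).
by apply: (maximal_preim (v := (1 : R) : R^c^o)) => //=; rewrite /lmul mulr1.
Qed.

Definition jacobson_pred : {pred R^c^o} := fun x => `[< jacobson (x : R) >].

Lemma jacobson_closed : submod_closed jacobson_pred.
Proof.
split; first by apply/asboolP => U _; rewrite rpred0.
move=> a x y /asboolP Jx /asboolP Jy; apply/asboolP => U maxU.
by rewrite rpredD ?rpredZ ?Jx ?Jy.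
Qed.

HB.instance Definition _ :=
  GRing.isSubmodClosed.Build R^c R^c^o jacobson_pred jacobson_closed.

Definition jacobson_submod : submodClosed R^c^o := jacobson_pred.

End Jacobson.

(** * Socles and tops of principal right ideals *)

Lemma pi_factorZ (S : pzRingType) (V : lmodType S) (U : submodClosed V) a (x : V) :
  a *: \pi_(factor_type U) x = \pi_(factor_type U) (a *: x).
Proof. exact: pi_factor_scale. Qed.

Lemma pi_factor_eq0 (S : pzRingType) (V : lmodType S) (U : submodClosed V) (x : V) :
  (\pi_(factor_type U) x == 0) = (x \in U).
Proof.
have -> : (0 : factor_type U) = \pi_(factor_type U) 0.
  by apply: (addrI (\pi_(factor_type U) x)); rewrite addr0 -pi_factorD addr0.
by rewrite -(Quotient.idealrBE (zmod_pred U)) subr0.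
Qed.

Section Principal.
Variable R : pzRingType.
Implicit Types (e r : R).

Lemma lmul_principal e (r : R^c^o) : lmul e r \in cyclic_submod (e : R^c^o).
Proof. by apply/asboolP; exists r. Qed.

Definition principal_elt e (r : R^c^o) : right_principal e :=
  exist _ (lmul e r) (lmul_principal e r).

Lemma linear_principal_elt e : linear (principal_elt e).
Proof. by move=> a x y; apply: val_inj; exact: linear_lmul. Qed.

HB.instance Definition _ e :=
  GRing.isLinear.Build R^c R^c^o (right_principal e) _ (principal_elt e)
    (@linear_principal_elt e).

Lemma val_principal e (v : right_principal e) : exists r, val v = e * r.
Proof. by case: v => v /= /asboolP. Qed.

(** [(eR)J] is contained in [J] because [J] is a left ideal; conversely, an
    element [x] of [eR] in [J] is the product [e x]. *)
Lemma ideal_mul_jacobson e (v : right_principal e) :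
  e * e = e ->
  v \in ideal_mul (right_principal e) (@jacobson R) <-> jacobson (val v : R).
Proof.
move=> ee; split=> [/asboolP vJ|Jv].
  pose U := preim_submod (val : {linear right_principal e -> R^c^o}) (jacobson_submod R).
  have : v \in U; last by move/asboolP.
  apply: vJ => _ [a [x [Ja ->]]]; apply/asboolP; exact: jacobson_lmul.
apply: mem_submod_span; exists (val v : R), (principal_elt e (1 : R)); split=> //.
apply: val_inj; have [r vr] := val_principal v.
by rewrite vr; change (e * r = e * 1 * (e * r)); rewrite mulr1 mulrA ee.
Qed.

(** Let [v] in [eR] avoid a maximal right ideal [U].  Then [e] is not in [U], and
    [e - v s] is in [U] for some [s].  Multiplying by [e] on the right, [v s e]
    is congruent to [e] modulo [U], so it is not in the radical.  Scalars act on
    the right, so [e *: (r *: t)] is [t r e]. *)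
Lemma right_top_mul_neq0 e (t : right_top (right_principal e)) :
  e * e = e -> t != 0 -> exists r : R^c, (e : R^c) *: (r *: t) != 0.
Proof.
move=> ee; elim/quotW: t => v.
rewrite pi_factor_eq0 => vI.
have /existsNP [U /not_implyP [maxU /negP vU]] : ~ jacobson (val v : R).
  by move/(ideal_mul_jacobson v ee); exact/negP.
have [r0 vr0] := val_principal v.
have eU : (e : R^c^o) \notin U.
  by apply: contraNN vU => eU; rewrite vr0; exact: rpredMr.
have [s esU] := maximal_submodP (e : R^c^o) maxU vU.
exists s; rewrite (pi_factorZ _ s) (pi_factorZ _ (e : R^c)) pi_factor_eq0.
apply/negP => /ideal_mul_jacobson-/(_ ee) /(_ U maxU) vseU.
case/negP: eU.
have -> : (e : R^c^o) =
    (e : R^c) *: ((e : R^c^o) - s *: val v) + val ((e : R^c) *: (s *: v)).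
  rewrite scalerBr subrK; exact: esym ee.
by rewrite rpredD //; apply: rpredZ.
Qed.

(** The isomorphism transports [right_top_mul_neq0] from [top(e'R)] to the
    socle of [eR], where [u] lies as the image of itself under left
    multiplication by [e]. *)
Lemma soc_mul_neq0 e e' (u : R) :
  lmod_iso (right_soc_type (right_principal e)) (right_top (right_principal e')) ->
  e' * e' = e' -> u \in soc R^c^o -> e * u = u -> u != 0 ->
  exists r : R, u * r * e' != 0.
Proof.
move=> [f [g fK gK]] ee' u_soc eu u0.
have esoc : principal_elt e u \in soc (right_principal e).
  exact: soc_linear u_soc.
pose v : right_soc_type (right_principal e) :=
  exist (fun w => w \in soc (right_principal e)) _ esoc.
have fv0 : f v != 0.
  rewrite -(linear0 f) (inj_eq (can_inj fK)); apply: contra_neq u0 => v0.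
  rewrite -eu; exact: (congr1 (fun w => val (val w) : R) v0).
have [r] := right_top_mul_neq0 ee' fv0.
rewrite -!linearZ => fvr0; exists (r : R); apply: contra_neq fvr0 => ur0.
rewrite [X in f X](_ : _ = 0) ?linear0 //; apply: val_inj; apply: val_inj.
by change (e * u * (r : R) * e' = 0); rewrite eu.
Qed.

End Principal.

(** * Matrices with a single nonzero entry *)

Section FormalMatrix.
Variables (n : nat) (F : formal_matrix_data n).

Lemma entry_fdelta i j (x : bimod F i j) : entry (fdelta x) i j = x.
Proof. by rewrite fmxE unit_entry_eq. Qed.

Lemma entry_fdelta0 i j (x : bimod F i j) k l :
  (k != i) || (l != j) -> entry (fdelta x) k l = 0.
Proof.
by move=> kl; rewrite fmxE unit_entry_neq // xpair_eqE negb_and !(eq_sym i, eq_sym j).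
Qed.

Lemma entry_fdeltaM i j (x : bimod F i j) (A : fmatrix F) l :
  entry (fdelta x * A) i l = cmul x (entry A j l).
Proof.
rewrite fmxE (bigD1 j) //= entry_fdelta big1 ?addr0 // => k kj.
by rewrite entry_fdelta0 ?cmul0l // kj orbT.
Qed.

Lemma entry_fdeltaM0 i j (x : bimod F i j) (A : fmatrix F) k l :
  k != i -> entry (fdelta x * A) k l = 0.
Proof.
by move=> ki; rewrite fmxE big1 // => p _; rewrite entry_fdelta0 ?cmul0l // ki.
Qed.

Lemma fdeltaM i j l (x : bimod F i j) (y : bimod F j l) :
  fdelta x * fdelta y = fdelta (cmul x y).
Proof.
apply: fmatrixP => p q; have [->|pi] := eqVneq p i; last first.
  by rewrite entry_fdeltaM0 // entry_fdelta0 ?pi.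
rewrite entry_fdeltaM; have [->|ql] := eqVneq q l; first by rewrite !entry_fdelta.
by rewrite !entry_fdelta0 ?cmul0r ?ql ?orbT.
Qed.

Lemma mul_canon_idem (A : fmatrix F) j l :
  canon_idem F j * A * canon_idem F l = fdelta (entry A j l).
Proof.
apply: fmatrixP => p q; rewrite -mulrA; have [->|pj] := eqVneq p j; last first.
  by rewrite entry_fdeltaM0 // entry_fdelta0 ?pj.
rewrite entry_fdeltaM cmul1l fmxE (bigD1 l) //= big1 ?addr0 => [|k kl].
  have [->|ql] := eqVneq q l; first by rewrite !entry_fdelta cmul1r.
  by rewrite !entry_fdelta0 ?cmul0r ?ql ?orbT.
by rewrite entry_fdelta0 ?cmul0r ?kl.
Qed.

Lemma fdelta_eq0 i j (x : bimod F i j) : (fdelta x == 0) = (x == 0).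
Proof.
apply/eqP/eqP => [|->].
  by move/(congr1 (fun A => entry A i j)); rewrite !fmxE unit_entry_eq.
apply: fmatrixP => p q; rewrite !fmxE; have [[<- <-]|ij] := eqVneq (i, j) (p, q).
  exact: unit_entry_eq.
exact: unit_entry_neq.
Qed.

(** * One step along the permutation *)

(** Every nonzero right ideal [xR] with [x] in [B_{i,j}] meets the socle of
    [e_i R], and no nonzero element of that socle is annihilated by [R e_{s(i)}].
    So some product of [x] with an element of [B_{j,s(i)}] is nonzero. *)
Lemma nakayama_nonzero (s : {perm 'I_n}) i j :
  nakayama_permutation F s -> right_socle_essential (fmatrix F) ->
  nonzero_bimod F i j -> nonzero_bimod F j (s i).
Proof.
have ee l : canon_idem F l * canon_idem F l = canon_idem F l.
  by rewrite fdeltaM cmul1l.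
move=> nakF essF [x x0].
have [|u [u_soc /asboolP [a ua] u0]] :=
    essF (cyclic_submod (fdelta x : (fmatrix F)^c^o)).
  by exists (fdelta x); [exact: mem_cyclic_submod | rewrite fdelta_eq0].
have {}ua : u = fdelta x * (a : fmatrix F) :> fmatrix F by [].
have eu : canon_idem F i * (u : fmatrix F) = u.
  by rewrite ua mulrA fdeltaM cmul1l.
have [r] := soc_mul_neq0 (nakF i).1 (ee (s i)) u_soc eu u0.
have -> : (u : fmatrix F) = fdelta x * (canon_idem F j * (a : fmatrix F)).
  by rewrite mulrA fdeltaM cmul1r.
rewrite -(mulrA (fdelta x)) -(mulrA (canon_idem F j)) -[_ * _ * canon_idem F _]mulrA.
rewrite mul_canon_idem fdeltaM fdelta_eq0 => xy0.
exists (entry ((a : fmatrix F) * r) j (s i)).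
by apply: contra_neq xy0 => ->; rewrite cmul0r.
Qed.

End FormalMatrix.

Theorem proposition19 (n : nat) (F : formal_matrix_data n.+1)
  (localF : local_coordinates F)
  (basicF : basic F)
  (nakF : nakayama_permutation F (full_cycle n.+1))
  (socF : right_socle_essential (fmatrix F))
  (i k : 'I_n.+1) (k_neq0 : k != 0) (k_neq1 : k != Zp1)
  (Bik : nonzero_bimod F i (i + k)) (j : 'I_n.+1) :
  nonzero_bimod F j (j + k) /\ nonzero_bimod F j (j - k + Zp1).
Proof.
have step p q : nonzero_bimod F p q -> nonzero_bimod F q (p + Zp1).
  move=> Bpq; have -> : p + Zp1 = full_cycle n.+1 p.
    by rewrite permE; apply: val_inj; rewrite /= modnDmr addn1.
  exact: nakayama_nonzero nakF socF Bpq.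
(* Two applications of [step] shift both indices by one, and the shift by one
   is transitive on the indices. *)
have Bk p : nonzero_bimod F p (p + k).
  have -> : p = i + Zp1 *+ (p - i)%R.
    rewrite -{1}(subrKC i p) Zp_mulrn; congr (_ + _); apply: val_inj => /=.
    by rewrite modnMml mul1n modn_mod.
  elim: (nat_of_ord _) => [|m IHm]; first by rewrite mulr0n addr0.
  by rewrite mulrS [Zp1 + _]addrC addrA [_ + k]addrAC; apply/step/step.
by split; last (apply: step; rewrite -{2}(subrK k j)).
Qed.
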